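(* Let $G$ be a group and let $\sigma,\tau$ be topologies on $G$ such that $(G,\sigma)$ is a $T_2$ feebly compact paratopological group, $(G,\tau)$ is a $T_3$ semitopological group and $\tau\subset\sigma$. Then $(G,\tau)$ is a topological group.
   Context: A semitopological group is a group $G$ endowed with a topology such that the multiplication map $G\times G\to G$, $(x,y)\mapsto xy$, is separately continuous. A paratopological group is a group with a topology for which the multiplication $G\times G\to G$ is (jointly) continuous. A topological group is a paratopological group whose inversion $x\mapsto x^{-1}$ is continuous. A topological space $X$ is feebly compact if each locally finite family of nonempty open subsets of $X$ is finite. $T_2$ means Hausdorff. A space $X$ is $T_3$ if any closed set $F\subset X$ and any point $x\in X\setminus F$ have disjoint neighborhoods ($T_3$ does not include $T_1$ or $T_0$). No separation axioms are assumed unless stated; in particular, topological groups are not assumed to be Hausdorff. *)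

(* Defs.v *)
From mathcomp Require Import all_boot.
From mathcomp Require Import all_classical topology.

Set Implicit Arguments.
Unset Strict Implicit.
Unset Printing Implicit Defensive.

Local Open Scope classical_set_scope.

Section Spaces.
Variable X : topologicalType.

Definition locally_finite (F : set (set X)) : Prop :=
  forall x : X, exists2 U : set X, nbhs x U &
    finite_set [set A : set X | F A /\ A `&` U !=set0].

Definition feebly_compact : Prop :=
  forall F : set (set X), (forall A : set X, F A -> open A /\ A !=set0) ->
    locally_finite F -> finite_set F.

(* Neither T1 nor T0 is included. *)
Definition t3_space : Prop :=
  forall (F : set X) (x : X), closed F -> ~ F x ->
    exists U V : set X,
      [/\ open U, open V, F `<=` U, V x & U `&` V = set0].

Lemma t3_spaceE : t3_space <-> @regular_space X.
Proof.
split=> [T3 x A|reg F x clF Fx].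
  move=> nA.
  have [||U [V [oU oV BU Vx UV0]]] := T3 (~` A°) x.
  - exact/open_closedC/open_interior.
  - by move=> /(_ nA).
  exists V; first exact: open_nbhs_nbhs.
  apply: subset_trans (@interior_subset _ A) => y clVy.
  apply: contrapT => /BU Uy.
  have [z [Vz Uz]] := clVy U (open_nbhs_nbhs (conj oU Uy)).
  by have : (U `&` V) z by []; rewrite UV0.
have nF : nbhs x (~` F) by apply: open_nbhs_nbhs; split=> //; exact: closed_openC.
have [V Vx VF] := reg x _ nF.
exists (~` closure V), V°; split.
- by apply: closed_openC; exact: closed_closure.
- exact: open_interior.
- by move=> y Fy /VF.
- exact: Vx.
- rewrite -subset0 => y [nVy /interior_subset Vy].
  exact/nVy/subset_closure.
Qed.

End Spaces.

(* A topology on G is a [Topological] structure on its carrier, so that one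
   group can carry several topologies; [topospace t] is the space (G, t). *)
Definition topospace (G : Type) (t : Topological G) : topologicalType :=
  Topological.Pack t.

Section Groups.
Variables (G : groupType) (t : Topological G).
Local Open Scope group_scope.
Local Notation T := (topospace t).

Definition semitopological_group : Prop :=
  (forall x : G, continuous (fun y : T => x * y : T)) /\
  (forall y : G, continuous (fun x : T => (x : G) * y : T)).

Definition paratopological_group : Prop :=
  continuous (fun xy : T * T => (xy.1 : G) * xy.2 : T).

Definition topological_group : Prop :=
  paratopological_group /\ continuous (fun x : T => (x : G)^-1 : T).

End Groups.

(* Main.v *)
Require Import Defs.
From mathcomp Require Import all_boot.
From mathcomp Require Import all_classical topology.

(** Why the theorem holds.

  If [tau] were given by continuous real functions, one would argue as follows.
  A [tau]-continuous function [f] is [sigma]-continuous, hence uniformly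
  continuous because [sigma] is feebly compact: [f (g o)] is close to [f g] for
  all [g] as soon as [o] is in some [sigma]-neighborhood [O] of 1.  Finitely
  many translates [h O] cover the group, and for each of these [h] separate
  continuity makes [f (x h)] close to [f h] when [x] is [tau]-close to 1.
  Therefore [f (x g)] is close to [f g] uniformly in [g], and such a uniform
  estimate controls products and inverses alike.

  A T3 topology need not have enough continuous functions, so [f] is replaced
  by a short chain of open sets, each containing the closure of the previous
  one.  Three facts about a feebly compact paratopological group carry the
  proof.
  - [inverse_almost_continuous]: inversion is continuous up to a closure.
  - [precompact]: finitely many translates of the closure of a neighborhood of 1
    cover the group, with control of both quotients [h^-1 x] and [x^-1 h].  The
    second is where almost continuity of inversion is used.
  - [uniform_separation]: open sets [A] and [C] with disjoint closures satisfy
    [A O `&` C = set0] for some neighborhood [O] of 1.  This is the substitute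
    for uniform continuity.
  The finite cover then yields [uniform_translation]: if [A0, A1, A2, A3] is a
  chain of [tau]-open sets as above, then [V A0] lies in the [tau]-closure of
  [A3] for some [tau]-neighborhood [V] of 1.  For a chain of neighborhoods of 1
  this is continuity of multiplication at (1, 1).  Applied to the complements of
  the closures of such a chain it gives continuity of inversion at 1: if [x] is
  in [V] and [x^-1] is outside the largest set, then [1 = x x^-1] falls outside
  a set that contains 1. *)

Set Implicit Arguments.
Unset Strict Implicit.
Unset Printing Implicit Defensive.

Local Open Scope classical_set_scope.

(** * Closures and cluster points *)

Section Topology.
Variable X : topologicalType.

Lemma t3_space_shrink (x : X) (U : set X) : t3_space X -> nbhs x U ->
  exists2 V : set X, open_nbhs x V & closure V `<=` U.
Proof.
move=> /t3_spaceE regX nU; have [V nV VU] := regX _ _ nU.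
exists V^°.
  by split; [exact: open_interior|exact: nbhs_singleton (nbhs_interior nV)].
exact: subset_trans (closureS (@interior_subset X V)) VU.
Qed.

Lemma closureC_closure (A B : set X) : open B -> closure A `<=` B ->
  closure (~` closure B) `<=` ~` closure A.
Proof.
move=> oB AB x clx /AB Bx.
have [y [nBy By]] := clx B (open_nbhs_nbhs (conj oB Bx)).
exact/nBy/subset_closure.
Qed.

(** Feeble compactness speaks of sets of open sets, while the constructions
  below produce sequences, in which a set could occur infinitely often.
  Without a cluster point this is impossible, since a point of the repeated set
  would be one. *)
Lemma feebly_compact_cluster (E : nat -> set X) :
    feebly_compact X -> (forall n, open (E n)) -> (forall n, E n !=set0) ->
  exists x : X, forall (U : set X) n, nbhs x U ->
    exists2 m, n < m & E m `&` U !=set0.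
Proof.
move=> fcX oE E0; apply: contrapT => /forallNP noE.
have far (x : X) : exists Un : set X * nat,
    nbhs x Un.1 /\ forall m, Un.2 < m -> E m `&` Un.1 = set0.
  have /existsNP[U /existsNP[n /not_implyP[nU noM]]] := noE x.
  exists (U, n); split=> // m nm; apply/eqP/negP => /negP/set0P EU.
  by apply: noM; exists m.
have fin : finite_set (range E).
  apply: fcX => [A [n _ <-]|x]; first by split; [exact: oE|exact: E0].
  have [[U n] [nU farU]] := far x; exists U => //=.
  apply: sub_finite_set (finite_image E (finite_II n.+1)).
  move=> _ [[m _ <-] EU]; exists m => //=; rewrite ltnS leqNgt.
  by apply/negP => /farU E_U; move: EU; rewrite E_U => -[].
have rare A : exists k, range E A -> forall m, k < m -> E m <> A.
  have [[n _ EnA]|] := pselect (range E A); last by exists 0.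
  have [x Ax] := E0 n; have [[U k] /= [nU farU]] := far x.
  exists k => _ m km EmA; have : (E m `&` U) x.
    by split; [rewrite EmA -EnA|exact: nbhs_singleton].
  by rewrite farU.
have {rare}[k rare] := choice rare.
apply: infinite_nat.
apply: sub_finite_set (bigcup_finite fin (fun A _ => finite_II (k A).+1)).
move=> m _; exists (E m); first by exists m.
rewrite /= ltnS leqNgt; apply/negP => km.
by apply: (rare (E m) _ m km) => //; exists m.
Qed.

End Topology.

(** * Translations in semitopological groups *)

Section Translations.
Variables (G : groupType) (t : Topological G).
Hypothesis Gt : semitopological_group t.
Local Open Scope group_scope.
Local Notation T := (topospace t).

Lemma nbhsMl (x y : G) (U : set G) :
  nbhs (x * y : T) U -> nbhs (y : T) [set z : G | U (x * z)].
Proof. exact: Gt.1. Qed.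

Lemma nbhsMr (x y : G) (U : set G) :
  nbhs (x * y : T) U -> nbhs (x : T) [set z : G | U (z * y)].
Proof. exact: Gt.2. Qed.

Lemma nbhs_lshift (x : G) (U : set G) :
  nbhs (1 : T) U -> nbhs (x : T) [set z : G | U (x^-1 * z)].
Proof. by move=> nU; apply: nbhsMl; rewrite mulVg. Qed.

Lemma openMl (x : G) (U : set G) :
  @open T U -> @open T [set z : G | U (x * z)].
Proof. by have /continuousP := Gt.1 x; apply. Qed.

Lemma closureMl (x y : G) (A B : set G) :
    (forall a, A a -> B (x * a)) -> @closure T A y -> @closure T B (x * y).
Proof.
move=> AB clA U /nbhsMl /clA[a [Aa Ua]].
by exists (x * a); split=> //; exact: AB.
Qed.

Lemma closureMr (x y : G) (A B : set G) :
    (forall a, A a -> B (a * y)) -> @closure T A x -> @closure T B (x * y).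
Proof.
move=> AB clA U /nbhsMr /clA[a [Aa Ua]].
by exists (a * y); split=> //; exact: AB.
Qed.

(** Separate continuity is enough here: one factor is moved to its closure at a
  time. *)
Lemma closureM (x y : G) (A B C : set G) :
    (forall a b, A a -> B b -> C (a * b)) ->
  @closure T A x -> @closure T B y -> @closure T C (x * y).
Proof.
move=> ABC clA clB; apply: closed_closure.
apply: closureMl clB => b Bb; apply: closureMr clA => a Aa; exact: ABC.
Qed.

End Translations.

(** * Feebly compact paratopological groups *)

Section FeeblyCompactParatopological.
Variables (G : groupType) (t : Topological G).
Hypothesis Gt : paratopological_group t.
Local Open Scope group_scope.
Local Notation T := (topospace t).

Lemma paratopological_semitopological : semitopological_group t.
Proof.
split=> [x y|y x] U nU.
- have [[A B] /= [nA nB] AB] := @Gt (x, y) U nU.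
  apply: filterS nB => z Bz; apply: (AB (x, z)); split=> //.
  exact: (@nbhs_singleton T x A nA).
- have [[A B] /= [nA nB] AB] := @Gt (x, y) U nU.
  apply: filterS nA => z Az; apply: (AB (z, y)); split=> //.
  exact: (@nbhs_singleton T y B nB).
Qed.
Let Gst := paratopological_semitopological.

Lemma nbhs1_sqrt (U : set G) : nbhs (1 : T) U ->
  exists V : set G, @open_nbhs T 1 V /\ forall x y, V x -> V y -> U (x * y).
Proof.
move=> nU; have := @Gt ((1, 1) : T * T) U; rewrite /= mulg1 => /(_ nU).
move=> -[[A B] /= [nA nB] ABU].
have : nbhs (1 : T) (A `&` B) by exact: filterI.
rewrite nbhsE => -[V oV VAB]; exists V; split=> // x y Vx Vy.
by apply: (ABU (x, y)); split=> /=; [apply: (VAB x Vx).1|apply: (VAB y Vy).2].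
Qed.

Hypothesis fcT : feebly_compact T.

(** Suppose that every neighborhood of 1 contains some [b] with [b^-1] outside
  [closure U].  Multiplying such elements gives points [x_n] with shrinking open
  neighborhoods [U_n], where [U_(n+1)] is contained in [x_(n+1) W] and
  [W W] in [U].  Then [E_n], the part of [U_n] outside [closure (x_(n+1) U)], is
  a neighborhood of [x_n] disjoint from [U_(n+1) W], thus from
  [closure U_(n+1) * W].  But a cluster point [f] of the [E_n] lies in all
  [closure U_n], and [f W] is a neighborhood of [f] that meets some [E_n]. *)
Lemma inverse_almost_continuous (U : set G) : nbhs (1 : T) U ->
  exists2 V : set G, nbhs (1 : T) V & forall x, V x -> @closure T U x^-1.
Proof.
move=> nU; apply: contrapT => noV.
have [W [[oW W1] WU]] := nbhs1_sqrt nU.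
have bad V : exists b : G, nbhs (1 : T) V -> V b /\ ~ @closure T U b^-1.
  have [nV|] := pselect (nbhs (1 : T) V); last by exists 1.
  apply: contrapT => /forallNP nob; apply: noV; exists V => // x Vx.
  by apply: contrapT => clx; apply: (nob x).
have {bad}[b bP] := choice bad.
(* A state is the pair of [x_n] and [U_n]. *)
pose next (s : G * set G) : G * set G :=
  let c := s.1 * b [set z | s.2 (s.1 * z)] in
  (c, s.2 `&` [set z | W (c^-1 * z)]).
pose s n := iter n next (1, setT).
have onext n : @open_nbhs T (s n).1 (s n).2.
  elim: n => [|n [oV Vx]] /=; first by split=> //; exact: openT.
  have /bP[Vb _] : nbhs (1 : T) [set z | (s n).2 ((s n).1 * z)].
    by apply: (nbhsMl Gst); rewrite mulg1; exact: open_nbhs_nbhs.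
  split; first by apply: openI => //; exact: (openMl Gst).
  by split=> //=; rewrite mulVg.
have nclU n : ~ @closure T U ((s n.+1).1^-1 * (s n).1).
  have /bP[_ nclb] : nbhs (1 : T) [set z | (s n).2 ((s n).1 * z)].
    apply: (nbhsMl Gst); rewrite mulg1; apply: open_nbhs_nbhs; exact: onext.
  by rewrite [(s n.+1).1]/= invgM -mulgA mulVg mulg1.
pose E n := (s n).2 `&` [set z | (~` @closure T U) ((s n.+1).1^-1 * z)].
have [||f fE] := @feebly_compact_cluster T E fcT.
- move=> n; apply: openI; first by have [] := onext n.
  apply: (openMl Gst) => //; apply: closed_openC; exact: closed_closure.
- by move=> n; exists (s n).1; split; [have [] := onext n|exact: nclU].
have s_decr m n : m <= n -> (s n).2 `<=` (s m).2.
  elim: n => [|n IH]; first by rewrite leqn0 => /eqP->.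
  by rewrite leq_eqVlt => /orP[/eqP->//|/IH{}IH] x [/IH].
have clf n : @closure T (s n).2 f.
  move=> N /fE -/(_ n)[m nm [x [[sx _] Nx]]].
  by exists x; split=> //; exact: (s_decr n m (ltnW nm)).
have nfW := nbhs_lshift Gst f (open_nbhs_nbhs (conj oW W1)).
have [n _ [g [[sg ncl] Wg]]] := fE _ 0 nfW.
apply: ncl; rewrite -(mulVKg f g) mulgA.
have clW : @closure T W ((s n.+1).1^-1 * f).
  by apply: (closureMl Gst) (clf n.+1) => // a [].
by apply: (closureMr Gst) clW => // a Wa; exact: WU.
Qed.

Lemma nbhs1_fourth (U : set G) : nbhs (1 : T) U ->
  exists V : set G, @open_nbhs T 1 V /\
    forall x y z w, V x -> V y -> V z -> V w -> U (x * y * (z * w)).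
Proof.
move=> /nbhs1_sqrt[V [/open_nbhs_nbhs/nbhs1_sqrt[W [nW WV]] VU]].
by exists W; split=> // x y z w Wx Wy Wz Ww; apply: VU; apply: WV.
Qed.

(** Otherwise there is a sequence of points [x_n], no two of which are close in
  both senses.  Small neighborhoods [x_n V] have a cluster point [y], so two of
  them contain points [z] and [z'] of [y V].  Going from [x_m] to [x_n] through
  [z], [y] and [z'] crosses two inverses of elements of [V], which almost
  continuity of inversion absorbs; the same path backwards gives the other
  quotient. *)
Lemma precompact (U : set G) : nbhs (1 : T) U ->
  exists F : seq G, forall x, exists2 h, h \in F &
    @closure T U (h^-1 * x) /\ @closure T U (x^-1 * h).
Proof.
move=> nU; apply: contrapT => /forallNP noF.
have {noF}far (F : seq G) : exists x, forall h, h \in F ->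
    ~ (@closure T U (h^-1 * x) /\ @closure T U (x^-1 * h)).
  have /existsNP[x xF] := noF F; exists x => h hF Uhx.
  by apply: xF; exists h.
have {far}[new far] := choice far.
pose s n := iter n (fun F => new F :: F) [::].
have in_s m n : m < n -> new (s m) \in s n.
  elim: n => // n IH; rewrite ltnS leq_eqVlt => /orP[/eqP->|/IH sn] /=.
    exact: mem_head.
  by rewrite inE sn orbT.
have [W [[oW W1] WU]] := nbhs1_fourth nU.
have nW : nbhs (1 : T) W by exact: open_nbhs_nbhs.
have [V0 nV0 V0W] := inverse_almost_continuous nW.
have : nbhs (1 : T) (V0 `&` W) by exact: filterI.
rewrite nbhsE => -[V [oV V1] VW].
have [y yE] : exists y : T, forall (A : set T) n, nbhs y A ->
    exists2 m, n < m & [set z : G | V ((new (s m))^-1 * z)] `&` A !=set0.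
  apply: feebly_compact_cluster fcT _ _ => n; first exact: (openMl Gst).
  by exists (new (s n)); rewrite /= mulVg.
have nyV : nbhs (y : T) [set z : G | V (y^-1 * z)].
  by apply: (nbhs_lshift Gst); exact: open_nbhs_nbhs.
have [m _ [z [/= Vz Vyz]]] := yE _ 0 nyV.
have [n mn [z' [/= Vz' Vyz']]] := yE _ m nyV.
have clU a b c d : V a -> V b -> V c -> V d ->
    @closure T U (a * b^-1 * (c * d^-1)).
  move=> /VW[_ Wa] /VW[Vb _] /VW[_ Wc] /VW[Vd _].
  apply: (closureM Gst (A := [set u * v | u in W & v in W])
    (B := [set u * v | u in W & v in W])).
  - move=> _ _ [p Wp [q Wq <-]] [p' Wp' [q' Wq' <-]]; exact: WU.
  - apply: (closureM Gst (A := W) (B := W)); last exact: V0W.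
      by move=> p q Wp Wq; exists p => //; exists q.
    exact: subset_closure.
  - apply: (closureM Gst (A := W) (B := W)); last exact: V0W.
      by move=> p q Wp Wq; exists p => //; exists q.
    exact: subset_closure.
apply: (far (s n) _ (in_s _ _ mn)); split.
- have -> : (new (s m))^-1 * new (s n) = (new (s m))^-1 * z * (y^-1 * z)^-1 *
     (y^-1 * z' * ((new (s n))^-1 * z')^-1).
    by rewrite !invgM !invgK !mulgA !mulgK.
  exact: clU.
- have -> : (new (s n))^-1 * new (s m) = (new (s n))^-1 * z' * (y^-1 * z')^-1 *
     (y^-1 * z * ((new (s m))^-1 * z)^-1).
    by rewrite !invgM !invgK !mulgA !mulgK.
  exact: clU.
Qed.

(** If no [O] works, choose successively neighborhoods [O_n] of 1 with
  [O_(n+1) O_(n+1)] contained in [O_n], elements [o_n] of [O_n] and nonempty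
  open sets [E_n] such that [E_n O_(n+1)] is contained in [A] and [E_n o_n] in
  [C].
  Let [y] be a cluster point of the [E_n].  Every [y O_n] meets [C], so the open
  sets [y O_n `&` C] have a cluster point [z], which is in [closure C].  The
  quotient [y^-1 z] is in every [closure O_n], whence [E_n (y^-1 z)] is
  contained in [closure A] for all [n].  Passing to the cluster point,
  [z = y (y^-1 z)] is in [closure A] as well. *)
Lemma uniform_separation (A C : set G) :
    @open T A -> @open T C -> @closure T A `&` @closure T C = set0 ->
  exists2 O : set G, nbhs (1 : T) O & forall a x, A a -> O x -> ~ C (a * x).
Proof.
move=> oA oC clAC; apply: contrapT => noO.
(* From [O_n], the step yields the triple of [O_(n+1)], [E_n] and [o_n]. *)
have step O : exists s : set G * set G * G, @open_nbhs T 1 O ->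
    [/\ @open_nbhs T 1 s.1.1, forall x y, s.1.1 x -> s.1.1 y -> O (x * y),
      @open T s.1.2 /\ s.1.2 !=set0,
      forall e x, s.1.2 e -> s.1.1 x -> A (e * x) &
      O s.2 /\ forall e, s.1.2 e -> C (e * s.2)].
  have [nO|] := pselect (@open_nbhs T 1 O); last by exists (O, O, 1).
  have [a [x [Aa Ox Cax]]] : exists a x, [/\ A a, O x & C (a * x)].
    apply: contrapT => /forallNP noax; apply: noO.
    exists O => [|a x Aa Ox Cax]; first exact: open_nbhs_nbhs.
    by apply: (noax a); exists x.
  have : nbhs (1 : T) (O `&` [set z | A (a * z)] `&` [set z | C (a * z * x)]).
    apply: filterI; first apply: filterI.
    - exact: open_nbhs_nbhs.
    - by apply: (nbhsMl Gst); rewrite mulg1; exact: open_nbhs_nbhs.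
    - apply: (nbhsMl Gst (U := [set z | C (z * x)])).
      by apply: (nbhsMr Gst); rewrite mulg1; exact: open_nbhs_nbhs.
  move=> /nbhs1_sqrt[O' [[oO' O'1] O'O]].
  have O'O1 z : O' z -> O z /\ C (a * z * x).
    by move=> O'z; have [[] ] := O'O _ _ O'z O'1; rewrite mulg1.
  exists (O', [set z | O' (a^-1 * z)], x) => _; split=> //=.
  - by move=> u v O'u O'v; have [[]] := O'O _ _ O'u O'v.
  - split; first exact: (openMl Gst).
    by exists a; rewrite /= mulVg.
  - by move=> e z /O'O O'e /O'e[[_ /=]]; rewrite mulgA mulVKg.
  - by split=> // e /O'O1[_]; rewrite mulVKg.
have {step}[step stepP] := choice step.
pose O n := iter n (fun O => (step O).1.1) setT.
have nO n : @open_nbhs T 1 (O n).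
  elim: n => [|n /stepP[]//]; split=> //; exact: openT.
pose E n := (step (O n)).1.2; pose o n := (step (O n)).2.
have OO n x y : O n.+1 x -> O n.+1 y -> O n (x * y).
  by have [_ /(_ x y)] := stepP _ (nO n).
have EO n e x : E n e -> O n.+1 x -> A (e * x).
  by have [_ _ _ /(_ e x)] := stepP _ (nO n).
have Eo n e : E n e -> C (e * o n).
  by have [_ _ _ _ [_ /(_ e)]] := stepP _ (nO n).
have O_decr m n : m <= n -> O n `<=` O m.
  elim: n => [|n IH]; first by rewrite leqn0 => /eqP->.
  rewrite leq_eqVlt => /orP[/eqP->//|/IH{}IH] x Ox; apply: IH.
  rewrite -(mulg1 x); apply: OO => //; exact: (nO n.+1).2.
have [y yE] : exists y : T, forall (U : set T) n, nbhs y U ->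
    exists2 m, n < m & E m `&` U !=set0.
  apply: feebly_compact_cluster fcT _ _ => n;
    by have [_ _ []] := stepP _ (nO n).
pose D n := C `&` [set z | O n (y^-1 * z)].
have [z zD] : exists z : T, forall (U : set T) n, nbhs z U ->
    exists2 m, n < m & D m `&` U !=set0.
  apply: feebly_compact_cluster fcT _ _ => n.
    by apply: openI => //; apply: (openMl Gst); exact: (nO n).1.
  (* The index [n.+1] leaves one halving for the factor [o m]. *)
  have nyO : nbhs (y : T) [set z : G | O n.+1 (y^-1 * z)].
    by apply: (nbhs_lshift Gst); exact: open_nbhs_nbhs.
  have [m nm [e [Eme /= Oe]]] := yE _ n.+1 nyO.
  exists (e * o m); split; first exact: Eo.
  rewrite /= mulgA; apply: OO => //; apply: (O_decr _ m (ltnW nm)).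
  by have [_ _ _ _ []] := stepP _ (nO m).
have clO n : @closure T (O n) (y^-1 * z).
  apply: (closureMl Gst (A := [set z | O n (y^-1 * z)])) => // U.
  move=> /zD-/(_ n)[m nm [v [[_ /= Ov] Uv]]]; exists v; split=> //.
  exact: (O_decr _ m (ltnW nm)).
suff : (@closure T A `&` @closure T C) z by rewrite clAC.
split; last by move=> U /zD-/(_ 0)[m _ [v [[Cv _] Uv]]]; exists v.
rewrite -(mulVKg y z).
have : @closure T (\bigcup_n E n) y.
  move=> U /yE-/(_ 0)[m _ [v [Emv Uv]]]; exists v; split=> //; by exists m.
move=> cly; apply: closed_closure; apply: (closureMr Gst) cly => e [n _ Ee].
by apply: (closureMl Gst) (clO n.+1) => x Ox; exact: (EO n).
Qed.

End FeeblyCompactParatopological.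

(** * A coarser semitopological group topology *)

Section CoarserTopology.
Variables (G : groupType) (sigma tau : Topological G).
Hypothesis Gsigma : paratopological_group sigma.
Hypothesis fc_sigma : feebly_compact (topospace sigma).
Hypothesis Gtau : semitopological_group tau.
Hypothesis tau_sigma :
  (@open (topospace tau) : set (set G)) `<=` @open (topospace sigma).
Local Open Scope group_scope.
Local Notation S := (topospace sigma).
Local Notation T := (topospace tau).
Let Ssigma := paratopological_semitopological Gsigma.

Lemma closure_tau (A : set G) : @closure S A `<=` @closure T A.
Proof.
move=> x clA U; rewrite nbhsE => -[V [oV Vx] VU].
have [a [Aa Va]] := clA V (open_nbhs_nbhs (conj (tau_sigma oV) Vx)).
by exists a; split=> //; exact: VU.
Qed.

(** This is [uniform_separation] for [A] and the complement of the
  [tau]-closure of [B]: their [sigma]-closures are disjoint because they are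
  smaller than the [tau]-closures. *)
Lemma uniform_nbhs (A B : set G) :
    @open T A -> @open T B -> @closure T A `<=` B ->
  exists2 O : set G, nbhs (1 : S) O &
    forall a x, A a -> @closure S O x -> @closure T B (a * x).
Proof.
move=> oA oB AB.
have [||O nO AO] := uniform_separation Gsigma fc_sigma (tau_sigma oA)
   (C := ~` @closure T B).
- by apply: tau_sigma; apply: closed_openC; exact: closed_closure.
- rewrite -subset0 => x [/closure_tau clA /closure_tau clC].
  exact: closureC_closure oB AB _ clC clA.
exists O => // a x Aa clO; apply: closed_closure; apply: closure_tau.
apply: (closureMl Ssigma) clO => y Oy.
by apply: contrapT; exact: AO.
Qed.

(** Given [a] in [A0], replace it by a close element [h] of the finite set [F].
  Such an [h] is in [A2]; separate continuity keeps [x h] in [A2] for all [x] in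
  a neighborhood that depends only on [F]; finally [x h] is replaced by the
  close element [x a].  The chain pays for the two replacements. *)
Lemma uniform_translation (A0 A1 A2 A3 : set G) :
    @open T A0 -> @open T A1 -> @open T A2 -> @open T A3 ->
    @closure T A0 `<=` A1 -> @closure T A1 `<=` A2 -> @closure T A2 `<=` A3 ->
  exists2 V : set G, nbhs (1 : T) V &
    forall x a, V x -> A0 a -> @closure T A3 (x * a).
Proof.
move=> o0 o1 o2 o3 A01 A12 A23.
have [O nO AO] := uniform_nbhs o0 o1 A01.
have [O' nO' AO'] := uniform_nbhs o2 o3 A23.
have [F FP] := precompact Gsigma fc_sigma (filterI nO nO').
exists [set x | forall h, h \in F -> A2 h -> A2 (x * h)].
  elim: F {FP} => [|h F IH]; first by apply: filterE.
  have nh : nbhs (1 : T) [set x | A2 h -> A2 (x * h)].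
    have [A2h|nA2h] := pselect (A2 h); last by apply: filterE => x /nA2h.
    have nA2 : nbhs (1 : T) [set x | A2 (x * h)].
      by apply: (nbhsMr Gtau); rewrite mul1g; exact: open_nbhs_nbhs.
    by apply: filterS nA2 => x A2xh _.
  apply: filterS (filterI nh IH) => x [xh xF] k.
  by rewrite inE => /orP[/eqP->|/xF].
move=> x a xF A0a; have [h hF [clha clah]] := FP a.
have A2h : A2 h.
  apply: A12; rewrite -(mulVKg a h); apply: AO => //.
  by apply: closureS clah => ? [].
rewrite -(mulVKg h a) mulgA; apply: AO'; first exact: xF.
by apply: closureS clha => ? [].
Qed.

End CoarserTopology.

(** * From the identity to the whole group *)

Section LocalCriterion.
Variables (G : groupType) (t : Topological G).
Local Open Scope group_scope.
Local Notation T := (topospace t).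

Lemma semitopological_group_topological : semitopological_group t ->
    (forall U : set G, nbhs (1 : T) U ->
      exists2 V : set G, nbhs (1 : T) V &
        forall x y, V x -> V y -> U (x * y)) ->
    (forall U : set G, nbhs (1 : T) U ->
      exists2 V : set G, nbhs (1 : T) V & forall x, V x -> U x^-1) ->
  topological_group t.
Proof.
move=> Gt mul1 inv1.
split=> [[a b] U /= nU|a U nU].
- have /mul1[V nV VU] : nbhs (1 : T) [set z | U (a * z * b)].
    apply: (nbhsMl Gt (U := [set z | U (z * b)])); apply: (nbhsMr Gt).
    by rewrite mulg1.
  exists ([set z : T | V (a^-1 * z)], [set z : T | V (z * b^-1)]) => /=.
    split; first exact: (nbhs_lshift Gt).
    by apply: (nbhsMr Gt); rewrite mulgV.
  move=> [x y] [/= Vx Vy]; have := VU _ _ Vx Vy.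
  by rewrite /= !mulgA mulgVK mulgV mul1g.
- have /inv1[V nV VU] : nbhs (1 : T) [set z | U (z * a^-1)].
    by apply: (nbhsMr Gt); rewrite mul1g.
  apply: filterS (nbhs_lshift Gt a nV) => x /VU /=.
  by rewrite invgM invgK mulgK.
Qed.

End LocalCriterion.

Theorem proposition6 (G : groupType) (sigma tau : Topological G)
  (hsigma : paratopological_group sigma)
  (hsigmaT2 : hausdorff_space (topospace sigma))
  (hsigmafc : feebly_compact (topospace sigma))
  (htau : semitopological_group tau)
  (htauT3 : t3_space (topospace tau))
  (htausigma : (@open (topospace tau) : set (set G)) `<=` @open (topospace sigma)) :
  topological_group tau.
Proof.
set T := topospace tau.
have shrink (U : set G) := @t3_space_shrink T 1%g U htauT3.
have translate := uniform_translation hsigma hsigmafc htau htausigma.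
apply: (semitopological_group_topological htau) => U nU.
- have [A3 n3 cl3] := shrink _ nU.
  have [A2 n2 cl2] := shrink _ (open_nbhs_nbhs n3).
  have [A1 n1 cl1] := shrink _ (open_nbhs_nbhs n2).
  have [A0 n0 cl0] := shrink _ (open_nbhs_nbhs n1).
  have [V nV VA] := translate _ _ _ _ n0.1 n1.1 n2.1 n3.1 cl0 cl1 cl2.
  exists (V `&` A0); first exact: filterI nV (open_nbhs_nbhs n0).
  by move=> x y [Vx _] [_ Ay]; apply/cl3/VA.
- have [A4 n4 cl4] := shrink _ nU.
  have [A3 n3 cl3] := shrink _ (open_nbhs_nbhs n4).
  have [A2 n2 cl2] := shrink _ (open_nbhs_nbhs n3).
  have [A1 n1 cl1] := shrink _ (open_nbhs_nbhs n2).
  have oC A : @open T (~` @closure T A).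
    by apply: closed_openC; exact: closed_closure.
  have [V nV VA] := translate _ _ _ _ (oC A4) (oC A3) (oC A2) (oC A1)
    (closureC_closure n4.1 cl3) (closureC_closure n3.1 cl2)
    (closureC_closure n2.1 cl1).
  exists V => // x Vx; apply/cl4; apply: contrapT => nA4.
  (* The translate [x x^-1 = 1] would be adherent to the complement of
     [closure A1], although [A1] is a neighborhood of 1. *)
  have := VA _ _ Vx nA4; rewrite mulgV => cl1C.
  have [y [nA1y A1y]] := cl1C A1 (open_nbhs_nbhs n1).
  exact/nA1y/subset_closure.
Qed.
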